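(* The Weyl algebra $\mathcal{W}$ acts on $\mathbf{B}$ by the following formulas: $$\alpha_k\mapsto\frac{\partial}{\partial x_k}\quad\text{if }k>0,\qquad \alpha_k\mapsto\text{multiplication by }-k\,x_{-k}\quad\text{if }k<0.$$ For each $h\in\mathbb{Z}$, the subspace $\mathbf{B}^{(h)}$ is preserved under this action and forms an irreducible representation of $\mathcal{W}$.
   Context: Bosonic Fock space is the complex vector space $\mathbf{B}=\mathbb{C}[x_1,x_2,x_3,\ldots;q,q^{-1}]$ (polynomial in the $x_k$, Laurent polynomial in $q$), and $\mathbf{B}^{(h)}=q^h\,\mathbb{C}[x_1,x_2,\ldots]$ for $h\in\mathbb{Z}$. The infinite dimensional Heisenberg algebra $\mathbf{H}$ is the associative $\mathbb{C}$-algebra generated by $\alpha_k$, $k\in\mathbb{Z}\setminus\{0\}$, and a central element $c$, subject to the relations $\alpha_j\alpha_k-\alpha_k\alpha_j=j\,\delta_{j,-k}\,c$. The Weyl algebra is $\mathcal{W}=\mathbf{H}/(c-1)$. *)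

(* Defs.v *)
From HB Require Import structures.
From mathcomp Require Import all_boot all_order all_algebra.
From mathcomp Require Import finmap generic_quotient.
From mathcomp Require Import boolp classical_sets reals.
From mathcomp Require Import complex.
From mathcomp Require Import monalg.

Set Implicit Arguments.
Unset Strict Implicit.
Unset Printing Implicit Defensive.

Import GRing.Theory Num.Theory.

Local Open Scope fset_scope.
Local Open Scope classical_set_scope.
Local Open Scope ring_scope.
Local Open Scope quotient_scope.

(* MathComp's algType excludes the zero ring.  An algebra given by generators  *)
(* and relations could a priori be zero, so an F-algebra is taken here to be   *)
(* a pzRingType with a central ring morphism from F; c acts by algscal c * x.  *)
HB.mixin Record hasCentralScalars (F : fieldType) A of GRing.PzRing A := {
  algscal : F -> A;
  algscal1 : algscal 1 = 1;
  algscalD : {morph algscal : c d / c + d};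
  algscalM : {morph algscal : c d / c * d};
  algscalC : forall (c : F) (x : A), algscal c * x = x * algscal c
}.

#[short(type="pzAlgType")]
HB.structure Definition PzAlgebra (F : fieldType) :=
  {A of GRing.PzRing A & hasCentralScalars F A}.

Section TwoSidedQuotient.
Context (F : fieldType) (A : pzAlgType F).

Definition two_sided_ideal (J : set A) : Prop :=
  [/\ J 0, (forall x y, J x -> J y -> J (x - y))
    & (forall a b x, J x -> J (a * x * b))].

Definition ideal_gen (S : set A) : set A :=
  [set x | forall J, two_sided_ideal J -> S `<=` J -> J x].

Context (S : set A).

Lemma ideal_gen_ideal : two_sided_ideal (ideal_gen S).
Proof.
split=> [J [] //|x y Jx Jy J hJ SJ|a b x Jx J hJ SJ].
  by have [_ hB _] := hJ; apply: hB; [apply: Jx|apply: Jy].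
by have [_ _ hM] := hJ; apply: hM; apply: Jx.
Qed.

Lemma ideal_genB x y : ideal_gen S x -> ideal_gen S y -> ideal_gen S (x - y).
Proof. by have [_ h _] := ideal_gen_ideal; apply: h. Qed.

Lemma ideal_gen0 : ideal_gen S 0.
Proof. by case: ideal_gen_ideal. Qed.

Lemma ideal_genN x : ideal_gen S x -> ideal_gen S (- x).
Proof. by move=> hx; rewrite -[- x]add0r; apply: ideal_genB => //; exact: ideal_gen0. Qed.

Lemma ideal_genD x y : ideal_gen S x -> ideal_gen S y -> ideal_gen S (x + y).
Proof. by move=> hx /ideal_genN /(ideal_genB hx); rewrite opprK. Qed.

Lemma ideal_genMl a x : ideal_gen S x -> ideal_gen S (a * x).
Proof.
by have [_ _ h] := ideal_gen_ideal => hx; rewrite -[_ * _]mulr1; apply: h.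
Qed.

Lemma ideal_genMr b x : ideal_gen S x -> ideal_gen S (x * b).
Proof.
by have [_ _ h] := ideal_gen_ideal => hx; rewrite -[x]mul1r; apply: h.
Qed.

Definition quot_equiv (x y : A) : bool := `[< ideal_gen S (x - y) >].

Lemma quot_equivP : equiv_class_of quot_equiv.
Proof.
split=> [x|x y|y x z].
- by apply/asboolP; rewrite subrr; exact: ideal_gen0.
- by apply/asboolP/asboolP => /ideal_genN; rewrite opprB.
- move=> /asboolP xy /asboolP yz; apply/asboolP.
  by rewrite -(subrKA y); apply: ideal_genD.
Qed.

Canonical quot_equiv_rel := EquivRelPack quot_equivP.

Definition quotalg := {eq_quot quot_equiv_rel}.

HB.instance Definition _ := Choice.on quotalg.
HB.instance Definition _ := EqQuotient.on quotalg.

Lemma quot_piP (x y : A) :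
  ideal_gen S (x - y) <-> \pi_quotalg x = \pi_quotalg y.
Proof.
by split=> [h|/eqP]; [apply/eqP|]; rewrite (@eqquotE _ _ quotalg);
  [apply/asboolP|move/asboolP].
Qed.

Definition quot_add (x y : quotalg) := \pi_quotalg (repr x + repr y).
Definition quot_opp (x : quotalg) := \pi_quotalg (- repr x).
Definition quot_mul (x y : quotalg) := \pi_quotalg (repr x * repr y).
Definition quot_scalar (c : F) := \pi_quotalg (algscal c : A).

Lemma repr_pi x : ideal_gen S (repr (\pi_quotalg x) - x).
Proof. by apply/quot_piP; rewrite reprK. Qed.

Lemma pi_addE x y : quot_add (\pi_quotalg x) (\pi_quotalg y) = \pi_quotalg (x + y).
Proof.
by apply/quot_piP; rewrite opprD addrACA; apply: ideal_genD; exact: repr_pi.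
Qed.

Lemma pi_oppE x : quot_opp (\pi_quotalg x) = \pi_quotalg (- x).
Proof. by apply/quot_piP; rewrite -opprD; apply: ideal_genN; exact: repr_pi. Qed.

Lemma pi_mulE x y : quot_mul (\pi_quotalg x) (\pi_quotalg y) = \pi_quotalg (x * y).
Proof.
apply/quot_piP; set a := repr _; set b := repr _.
rewrite -(subrKA (a * y)) -mulrBr -mulrBl.
by apply: ideal_genD; [apply: ideal_genMl|apply: ideal_genMr]; exact: repr_pi.
Qed.

Lemma quot_ind (P : quotalg -> Prop) : (forall x, P (\pi_quotalg x)) -> forall x, P x.
Proof. by move=> h x; rewrite -[x]reprK; apply: h. Qed.

Fact quot_addA : associative quot_add.
Proof.
by elim/quot_ind=> x; elim/quot_ind=> y; elim/quot_ind=> z; rewrite !pi_addE addrA.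
Qed.
Fact quot_addC : commutative quot_add.
Proof. by elim/quot_ind=> x; elim/quot_ind=> y; rewrite !pi_addE addrC. Qed.
Fact quot_add0 : left_id (\pi_quotalg 0) quot_add.
Proof. by elim/quot_ind=> x; rewrite pi_addE add0r. Qed.
Fact quot_addN : left_inverse (\pi_quotalg 0) quot_opp quot_add.
Proof. by elim/quot_ind=> x; rewrite pi_oppE pi_addE addNr. Qed.

HB.instance Definition _ :=
  GRing.isZmodule.Build quotalg quot_addA quot_addC quot_add0 quot_addN.

Fact quot_mulA : associative quot_mul.
Proof.
by elim/quot_ind=> x; elim/quot_ind=> y; elim/quot_ind=> z; rewrite !pi_mulE mulrA.
Qed.
Fact quot_mul1l : left_id (\pi_quotalg 1) quot_mul.
Proof. by elim/quot_ind=> x; rewrite pi_mulE mul1r. Qed.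
Fact quot_mul1r : right_id (\pi_quotalg 1) quot_mul.
Proof. by elim/quot_ind=> x; rewrite pi_mulE mulr1. Qed.
Fact quot_mulDl : left_distributive quot_mul quot_add.
Proof.
by elim/quot_ind=> x; elim/quot_ind=> y; elim/quot_ind=> z;
  rewrite !(pi_addE, pi_mulE) mulrDl.
Qed.
Fact quot_mulDr : right_distributive quot_mul quot_add.
Proof.
by elim/quot_ind=> x; elim/quot_ind=> y; elim/quot_ind=> z;
  rewrite !(pi_addE, pi_mulE) mulrDr.
Qed.

HB.instance Definition _ := GRing.Zmodule_isPzRing.Build quotalg
  quot_mulA quot_mul1l quot_mul1r quot_mulDl quot_mulDr.

Fact quot_scalar1 : quot_scalar 1 = 1.
Proof. by rewrite /quot_scalar algscal1. Qed.
Fact quot_scalarD : {morph quot_scalar : c d / c + d}.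
Proof. by move=> c d; rewrite /quot_scalar algscalD -pi_addE. Qed.
Fact quot_scalarM : {morph quot_scalar : c d / c * d}.
Proof. by move=> c d; rewrite /quot_scalar algscalM -pi_mulE. Qed.
Fact quot_scalarC c (x : quotalg) : quot_scalar c * x = x * quot_scalar c.
Proof.
elim/quot_ind: x => x; rewrite /quot_scalar /GRing.mul /=.
by rewrite !pi_mulE algscalC.
Qed.

HB.instance Definition _ := hasCentralScalars.Build F quotalg
  quot_scalar1 quot_scalarD quot_scalarM quot_scalarC.

Definition quot_proj (x : A) : quotalg := \pi_quotalg x.

End TwoSidedQuotient.

Section FreeAlgebra.
Context (F : fieldType) (I : choiceType).

Definition freealg := {malg F[{fmonom I}]}.
HB.instance Definition _ := GRing.NzRing.on freealg.

Definition free_scalar (c : F) : freealg := c%:MP.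

Fact free_scalar1 : free_scalar 1 = 1.
Proof. exact: rmorph1. Qed.
Fact free_scalarD : {morph free_scalar : c d / c + d}.
Proof. exact: (@raddfD _ _ (@malgC {fmonom I} F)). Qed.
Fact free_scalarM : {morph free_scalar : c d / c * d}.
Proof. exact: (@rmorphM _ _ (@malgC {fmonom I} F)). Qed.
Fact free_scalarC c (x : freealg) : free_scalar c * x = x * free_scalar c.
Proof.
rewrite malgM_def [RHS]malgM_def fgmulUg fgmulgU.
by apply: eq_bigr => k _; rewrite mul1m mulm1 mulrC.
Qed.

HB.instance Definition _ := hasCentralScalars.Build F freealg
  free_scalar1 free_scalarD free_scalarM free_scalarC.

Definition freegen (i : I) : freealg := << fmu i >>.

End FreeAlgebra.

Definition nzint := {k : int | k != 0}.
Definition posn := {n : nat | (0 < n)%N}.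

Fact absnz_gt0 (k : nzint) : (0 < `|val k|)%N.
Proof. by rewrite absz_gt0; exact: (valP k). Qed.

Definition absnz (k : nzint) : posn := Sub `|val k|%N (absnz_gt0 k).

Section Heisenberg.
Context (F : fieldType).

(* The generator Some k stands for alpha_k, and None for c. *)
Definition heis_free := freealg F (option nzint).

Definition heis_rel : set heis_free :=
  let a k : heis_free := freegen F (Some k) in
  let c : heis_free := freegen F None in
  [set r | (exists j k : nzint,
              r = a j * a k - a k * a j
                  - algscal ((val j)%:~R * (val j == - val k)%:R : F) * c)
        \/ (exists k, r = c * a k - a k * c)].

Definition heisenberg := quotalg heis_rel.
HB.instance Definition _ := PzAlgebra.on heisenberg.

Definition heis_alpha (k : nzint) : heisenberg :=
  quot_proj heis_rel (freegen F (Some k)).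
Definition heis_c : heisenberg := quot_proj heis_rel (freegen F None).

Definition weyl_rel : set heisenberg := [set heis_c - 1].
Definition weyl := quotalg weyl_rel.
HB.instance Definition _ := PzAlgebra.on weyl.

Definition alpha (k : nzint) : weyl := quot_proj weyl_rel (heis_alpha k).

End Heisenberg.

Section Fock.
Context (F : fieldType).

(* The pair (m, h) stands for the Laurent monomial x^m q^h.  The ring          *)
(* structure of malg is not available here: its monomials form a monoid        *)
(* without nontrivial units, whereas q is a unit.                              *)
Definition fmon := ({cmonom posn} * int)%type.
HB.instance Definition _ := Choice.on fmon.

Definition fmon_mul (m1 m2 : fmon) : fmon := (mmul m1.1 m2.1, m1.2 + m2.2).
Definition fmon_one : fmon := (mone, 0).

Lemma fmon_mulA : associative fmon_mul.
Proof. by move=> x y z; rewrite /fmon_mul /= mulmA addrA. Qed.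
Lemma fmon_mulC : commutative fmon_mul.
Proof. by move=> x y; rewrite /fmon_mul mulmC addrC. Qed.
Lemma fmon_mul1 : left_id fmon_one fmon_mul.
Proof. by case=> x h; rewrite /fmon_mul /= mul1m add0r. Qed.

Definition fock := {malg F[fmon]}.
HB.instance Definition _ := GRing.Lmodule.on fock.

Definition fock_one : fock := << fmon_one >>.
Definition fock_mul (f g : fock) : fock :=
  \sum_(m1 <- msupp f) \sum_(m2 <- msupp g)
    << f@_m1 * g@_m2 *g fmon_mul m1 m2 >>.

Lemma fock_mulEw (d1 d2 : {fset fmon}) (f g : fock) :
  (msupp f `<=` d1)%fset -> (msupp g `<=` d2)%fset ->
  fock_mul f g =
  \sum_(m1 <- d1) \sum_(m2 <- d2) << f@_m1 * g@_m2 *g fmon_mul m1 m2 >>.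
Proof.
move=> le1 le2; rewrite /fock_mul (big_fset_incl _ le1) /=.
  apply/eq_bigr=> k1 _; apply/big_fset_incl => // k _ /mcoeff_outdom ->.
  by rewrite mulr0 monalgU0.
move=> k _ /mcoeff_outdom fk.
by rewrite big1 // => k' _; rewrite fk mul0r monalgU0.
Qed.

Lemma fock_mulC : commutative fock_mul.
Proof.
move=> f g; rewrite /fock_mul exchange_big /=.
by do 2!apply: eq_bigr => ? _; rewrite mulrC fmon_mulC.
Qed.

Lemma fock_mulDl : left_distributive fock_mul +%R.
Proof.
move=> f1 f2 g.
rewrite (fock_mulEw (msuppD_le f1 f2) (fsubset_refl _)).
rewrite [X in _ = X + _](fock_mulEw (fsubsetUl _ (msupp f2)) (fsubset_refl _)).
rewrite [X in _ = _ + X](fock_mulEw (fsubsetUr (msupp f1) _) (fsubset_refl _)).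
rewrite -big_split /=; apply/eq_bigr=> k1 _.
rewrite -big_split /=; apply/eq_bigr=> k2 _.
by rewrite mcoeffD mulrDl monalgUD.
Qed.

Lemma fock_mul0l : left_zero 0 fock_mul.
Proof. by move=> g; rewrite /fock_mul msupp0 big_seq_fset0. Qed.

Lemma fock_mulUU c1 c2 m1 m2 :
  fock_mul << c1 *g m1 >> << c2 *g m2 >> = << c1 * c2 *g fmon_mul m1 m2 >>.
Proof. by rewrite (fock_mulEw msuppU_le msuppU_le) !big_seq_fset1 !mcoeffUU. Qed.

Lemma fock_mul_suml (f g : fock) :
  fock_mul f g = \sum_(m <- msupp f) fock_mul << f@_m *g m >> g.
Proof.
rewrite {1}[f]monalgE.
by rewrite (big_morph (fock_mul^~ _) (fun _ _ => fock_mulDl _ _ _) (fock_mul0l _)).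
Qed.

Lemma fock_ind (P : fock -> Prop) :
  P 0 -> (forall f g, P f -> P g -> P (f + g)) ->
  (forall c m, P << c *g m >>) -> forall f, P f.
Proof. by move=> P0 PD PU f; rewrite [f]monalgE; apply: big_ind. Qed.

Lemma fock_mulDr : right_distributive fock_mul +%R.
Proof. by move=> f g h; rewrite fock_mulC fock_mulDl !(fock_mulC f). Qed.

Lemma fock_mulA : associative fock_mul.
Proof.
move=> f g h; elim/fock_ind: f => [|f f' IHf IHf'|c m].
- by rewrite !fock_mul0l.
- by rewrite !fock_mulDl IHf IHf'.
elim/fock_ind: g => [|g g' IHg IHg'|c' m'].
- by rewrite [fock_mul _ 0]fock_mulC !fock_mul0l fock_mulC fock_mul0l.
- by rewrite fock_mulDl !fock_mulDr fock_mulDl IHg IHg'.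
elim/fock_ind: h => [|h h' IHh IHh'|c'' m''].
- by rewrite ![fock_mul _ 0]fock_mulC !fock_mul0l fock_mulC fock_mul0l.
- by rewrite !fock_mulDr IHh IHh'.
by rewrite !fock_mulUU mulrA fmon_mulA.
Qed.

Lemma fock_mul1l : left_id fock_one fock_mul.
Proof.
elim/fock_ind => [|f g IHf IHg|c m]; rewrite ?fock_mulDr ?IHf ?IHg //.
  by rewrite fock_mulC fock_mul0l.
by rewrite fock_mulUU mul1r fmon_mul1.
Qed.

Lemma fock_one_neq0 : fock_one != 0.
Proof. by rewrite monalgU_eq0 oner_eq0. Qed.

HB.instance Definition _ := GRing.Zmodule_isComNzRing.Build fock
  fock_mulA fock_mulC fock_mul1l fock_mulDl fock_one_neq0.

Lemma fock_scaleU (a c : F) (m : fmon) :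
  a *: (<< c *g m >> : fock) = << a * c *g m >>.
Proof. by apply/malgP=> k; rewrite mcoeffZ !mcoeffU mulrnAr. Qed.

Lemma fock_scaleAl (a : F) (f g : fock) : a *: (f * g) = (a *: f) * g.
Proof.
elim/fock_ind: f => [|f f' IHf IHf'|c m].
- by rewrite mul0r !scaler0 mul0r.
- by rewrite scalerDr !mulrDl scalerDr IHf IHf'.
elim/fock_ind: g => [|g g' IHg IHg'|c' m'].
- by rewrite !mulr0 scaler0.
- by rewrite !mulrDr scalerDr IHg IHg'.
rewrite fock_scaleU [X in _ *: X]fock_mulUU [RHS]fock_mulUU.
by rewrite fock_scaleU mulrA.
Qed.

HB.instance Definition _ := GRing.Lmodule_isLalgebra.Build F fock fock_scaleAl.
HB.instance Definition _ := GRing.Lalgebra_isComAlgebra.Build F fock.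

Definition fockX (k : posn) : fock := << (ucm k, 0) : fmon >>.

Definition fockq (h : int) : fock := << (mone, h) : fmon >>.

Definition fock_poly (p : {malg F[{cmonom posn}]}) : fock :=
  \sum_(m <- msupp p) << p@_m *g ((m, 0) : fmon) >>.

(* divcm truncates the exponent subtraction, but only where x_k does not       *)
(* occur, in which case the coefficient is 0.                                  *)
Definition fock_pderiv (k : posn) (f : fock) : fock :=
  \sum_(m <- msupp f)
    << f@_m * (m.1 k)%:R *g ((divcm m.1 (ucm k), m.2) : fmon) >>.

Definition fock_charge (h : int) : set fock :=
  [set fockq h * fock_poly p | p in [set: {malg F[{cmonom posn}]}]].

End Fock.

Section Representations.
Context (F : fieldType) (A : pzAlgType F) (V : lmodType F).

Definition is_representation (rho : A -> V -> V) : Prop :=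
  [/\ (forall a c u v, rho a (c *: u + v) = c *: rho a u + rho a v),
      (forall c a b v, rho (algscal c * a + b) v = c *: rho a v + rho b v),
      (forall v, rho 1 v = v)
    & (forall a b v, rho (a * b) v = rho a (rho b v))].

Definition is_subspace (U : set V) : Prop :=
  U 0 /\ forall c u v, U u -> U v -> U (c *: u + v).

Definition preserved (rho : A -> V -> V) (U : set V) : Prop :=
  forall a u, U u -> U (rho a u).

Definition irreducible_on (rho : A -> V -> V) (U : set V) : Prop :=
  U <> [set 0] /\
  forall U' : set V, is_subspace U' -> preserved rho U' -> U' `<=` U ->
    U' = [set 0] \/ U' = U.

End Representations.

(* Main.v *)
Require Import Defs.
From HB Require Import structures.
From mathcomp Require Import all_boot all_order all_algebra.
From mathcomp Require Import finmap.
From mathcomp Require Import boolp classical_sets reals.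
From mathcomp Require Import complex.
From mathcomp Require Import monalg.

Set Implicit Arguments.
Unset Strict Implicit.
Unset Printing Implicit Defensive.

Import Order.TTheory GRing.Theory Num.Theory.
Local Open Scope ring_scope.

(** Existence of the action.  A module over an algebra given by generators and
    relations is a family of linear operators, one for each generator, that
    satisfies the relations.  The free algebra acts by letting a word act as
    the composite of its letters ([free_act_rep]); the elements that act as
    zero form a two-sided ideal, so an action in which the relations vanish
    descends to the quotient ([quot_act_rep]).  This is used twice, for the
    Heisenberg algebra over the free algebra and for the Weyl algebra over the
    Heisenberg algebra.  With c acting as the identity, the relations reduce to
    the Leibniz rule d/dx_j (x_k f) = delta_jk f + x_k (df/dx_j)
    ([fock_pderivX]), the symmetry of second derivatives ([fock_pderivC]) and
    the commutativity of the ring.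

    Irreducibility.  Let U be a nonzero invariant subspace of the sector of
    charge h.  Take a nonzero f in U.  If a nonconstant monomial occurs in f,
    differentiate by a variable x_k of that monomial: in characteristic zero
    the coefficient is only multiplied by a positive integer, so the result is
    nonzero, and its degree is smaller.  By induction on the degree, U contains
    a nonzero multiple of q^h ([fock_charge_vacuum]).  Multiplying q^h by the
    variables then gives all monomials of charge h ([fock_charge_generated]),
    so U is the whole sector.  The operators alpha_k with k < 0 multiply by
    -k x_{-k} rather than by x_{-k}, which is again harmless in characteristic
    zero.  The argument is valid over any field of characteristic zero. *)

(** * Linear extension from a basis *)

Lemma malg_ind (K : choiceType) (G : zmodType) (P : {malg G[K]} -> Prop) :
  P 0 -> (forall f g, P f -> P g -> P (f + g)) ->
  (forall c k, P << c *g k >>) -> forall f, P f.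
Proof. by move=> P0 PD PU f; rewrite [f]monalgE; apply: big_ind. Qed.

(** Values are allowed to depend on the coefficient through [phi k], instead of
    being of the form [c *: phi k], so that [fock_pderiv] and [fock_poly], whose
    coefficients sit inside the monomials, are instances up to conversion. *)
Section LinearExtension.
Context (F : fieldType) (K : choiceType) (V : lmodType F) (phi : K -> F -> V).
Hypothesis phi_linear :
  forall k a b c, phi k (a * b + c) = a *: phi k b + phi k c.

Definition malg_extend (f : {malg F[K]}) : V :=
  \sum_(k <- msupp f) phi k f@_k.

Lemma malg_extend_phi0 k : phi k 0 = 0.
Proof.
have := phi_linear k 1 0 0; rewrite mulr0 addr0 scale1r.
by move/eqP; rewrite -subr_eq0 opprD addrA subrr sub0r oppr_eq0 => /eqP.
Qed.

Lemma malg_extendEw (d : {fset K}) f :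
  (msupp f `<=` d)%fset -> malg_extend f = \sum_(k <- d) phi k f@_k.
Proof.
move=> le; rewrite /malg_extend (big_fset_incl _ le) // => k _.
move=> /mcoeff_outdom ->.
exact: malg_extend_phi0.
Qed.

Lemma malg_extend_linear a f g :
  malg_extend (a *: f + g) = a *: malg_extend f + malg_extend g.
Proof.
pose d := (msupp (a *: f + g) `|` (msupp f `|` msupp g))%fset.
rewrite !(@malg_extendEw d) ?fsubsetUl //; last first.
- by rewrite /d fsetUCA fsubsetUl.
- by rewrite /d fsetUA fsubsetUr.
rewrite scaler_sumr -big_split; apply: eq_bigr => k _.
by rewrite mcoeffD mcoeffZ phi_linear.
Qed.

Lemma malg_extendU c k : malg_extend << c *g k >> = phi k c.
Proof. by rewrite (malg_extendEw msuppU_le) big_seq_fset1 mcoeffUU. Qed.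

End LinearExtension.

Lemma linear_map0 (F : fieldType) (V W : lmodType F) (op : V -> W) :
  (forall c u v, op (c *: u + v) = c *: op u + op v) -> op 0 = 0.
Proof.
by move=> lin; have := lin (-1) 0 0; rewrite scaler0 addr0 scaleN1r addNr.
Qed.

Lemma linear_mapD (F : fieldType) (V W : lmodType F) (op : V -> W) :
  (forall c u v, op (c *: u + v) = c *: op u + op v) ->
  {morph op : u v / u + v}.
Proof. by move=> lin u v; have := lin 1 u v; rewrite !scale1r. Qed.

Section Subspace.
Context (F : fieldType) (V : lmodType F) (U : set V).
Hypothesis subU : is_subspace U.

Lemma subspaceD u v : U u -> U v -> U (u + v).
Proof. by case: subU => _ h Uu Uv; rewrite -[u]scale1r; apply: h. Qed.

Lemma subspaceZ c u : U u -> U (c *: u).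
Proof. by case: subU => U0 h Uu; rewrite -[_ *: _]addr0; apply: h. Qed.

Lemma subspace_sum (I : Type) (r : seq I) (P : pred I) (f : I -> V) :
  (forall i, P i -> U (f i)) -> U (\sum_(i <- r | P i) f i).
Proof. by apply: big_ind; [case: subU|exact: subspaceD]. Qed.

End Subspace.

(** * Representations from generators and relations *)

Section FreeAction.
Context (F : fieldType) (I : choiceType) (V : lmodType F) (op : I -> V -> V).
Hypothesis op_linear :
  forall i c u v, op i (c *: u + v) = c *: op i u + op i v.

Definition word_act (m : {fmonom I}) (v : V) : V := foldr op v m.

Definition free_act (f : freealg F I) (v : V) : V :=
  malg_extend (fun m c => c *: word_act m v) f.

Lemma word_act_linear m c u v :
  word_act m (c *: u + v) = c *: word_act m u + word_act m v.
Proof. by rewrite /word_act; elim: (m : seq I) => //= i s ->. Qed.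

Let word_scale_linear v m (a b c : F) :
  (a * b + c) *: word_act m v = a *: (b *: word_act m v) + c *: word_act m v.
Proof. by rewrite scalerDl scalerA. Qed.

Lemma free_actU c m v : free_act << c *g m >> v = c *: word_act m v.
Proof. exact: malg_extendU (word_scale_linear v) _ _. Qed.

Lemma free_act_linear_l a (f g : freealg F I) v :
  free_act (a *: (f : {malg F[_]}) + g) v = a *: free_act f v + free_act g v.
Proof. exact: malg_extend_linear (word_scale_linear v) _ _ _. Qed.

Lemma free_actD (f g : freealg F I) v :
  free_act (f + g) v = free_act f v + free_act g v.
Proof. by have := free_act_linear_l 1 f g v; rewrite !scale1r. Qed.

Lemma free_act0 v : free_act 0 v = 0.
Proof. exact: linear_map0 (fun c f g => free_act_linear_l c f g v). Qed.

Lemma free_act_linear_r f c u v :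
  free_act f (c *: u + v) = c *: free_act f u + free_act f v.
Proof.
rewrite /free_act /malg_extend scaler_sumr -big_split; apply: eq_bigr => m _ /=.
by rewrite word_act_linear scalerDr !scalerA mulrC.
Qed.

Lemma free_actM (f g : freealg F I) v :
  free_act (f * g) v = free_act f (free_act g v).
Proof.
elim/malg_ind: f => [|f f' IHf IHf'|c m].
- by rewrite mul0r !free_act0.
- by rewrite mulrDl !free_actD IHf IHf'.
elim/malg_ind: g => [|g g' IHg IHg'|c' m'].
- by rewrite mulr0 free_act0 (linear_map0 (free_act_linear_r _)).
- by rewrite mulrDr !free_actD IHg IHg' (linear_mapD (free_act_linear_r _)).
rewrite [_ * _]malgM_def fgmulUU !free_actU.
rewrite -[c' *: _]addr0 word_act_linear.
rewrite (linear_map0 (word_act_linear m)) addr0 scalerA.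
by rewrite /word_act fmM foldr_cat.
Qed.

Lemma free_act_gen i v : free_act (freegen F i) v = op i v.
Proof. by rewrite /freegen free_actU scale1r /word_act fmU. Qed.

Lemma free_act_rep : is_representation free_act.
Proof.
split=> [||v|].
- exact: free_act_linear_r.
- move=> c a b v; rewrite -free_act_linear_l; congr (free_act (_ + _) v).
  exact: mul_malgC.
- by rewrite free_actU scale1r /word_act fm1.
- exact: free_actM.
Qed.

Lemma free_act_preserved (U : set V) :
  is_subspace U -> (forall i u, U u -> U (op i u)) -> preserved free_act U.
Proof.
move=> subU opU f u Uu; apply: subspace_sum => // m _; apply: subspaceZ => //.
by rewrite /word_act; elim: (m : seq I) => //= i s; apply: opU.
Qed.

End FreeAction.

Section QuotientAction.
Context (F : fieldType) (A : pzAlgType F) (V : lmodType F) (S : set A).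
Context (rho : A -> V -> V).
Hypothesis rho_rep : is_representation rho.
Hypothesis rho_rel : forall s v, S s -> rho s v = 0.

Definition quot_act (x : quotalg S) (v : V) : V := rho (repr x) v.

Lemma rep0 v : rho 0 v = 0.
Proof.
have [_ lin _ _] := rho_rep; have := lin (-1) 0 0 v.
by rewrite mulr0 addr0 scaleN1r addNr.
Qed.

Lemma repD a b v : rho (a + b) v = rho a v + rho b v.
Proof.
have [_ lin _ _] := rho_rep; have := lin 1 a b v.
by rewrite algscal1 mul1r scale1r.
Qed.

Lemma repB a b v : rho (a - b) v = rho a v - rho b v.
Proof. by apply/eqP; rewrite eq_sym subr_eq -repD subrK. Qed.

Lemma repZ c a v : rho (algscal c * a) v = c *: rho a v.
Proof.
by have [_ lin _ _] := rho_rep; rewrite -[_ * a]addr0 lin rep0 addr0.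
Qed.

(** The annihilator of a representation is a two-sided ideal. *)
Lemma rho_ideal x v : ideal_gen S x -> rho x v = 0.
Proof.
have [linr linl rho1 rhoM] := rho_rep.
move=> /(_ [set y | forall v, rho y v = 0]%classic).
apply=> [|s Ss w]; last exact: rho_rel.
split=> [w|y z y0 z0 w|a b y y0 w] /=; first exact: rep0.
- by rewrite repB y0 z0 subr0.
- by rewrite !rhoM y0 (linear_map0 (linr a)).
Qed.

Lemma quot_act_proj a v : quot_act (quot_proj S a) v = rho a v.
Proof.
by apply/eqP; rewrite -subr_eq0 -repB; apply/eqP/rho_ideal; exact: repr_pi.
Qed.

Lemma quot_proj_ind (P : quotalg S -> Prop) :
  (forall x, P (quot_proj S x)) -> forall x, P x.
Proof. exact: quot_ind. Qed.

Lemma quot_act_rep : is_representation quot_act.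
Proof.
have [linr linl rho1 rhoM] := rho_rep.
split=> [x|c x y v|v|x y v].
- exact: linr.
- elim/quot_proj_ind: x => x; elim/quot_proj_ind: y => y.
  have -> : algscal c * quot_proj S x + quot_proj S y
            = quot_proj S (algscal c * x + y) :> quotalg S.
    by rewrite /quot_proj -pi_addE -pi_mulE.
  by rewrite !quot_act_proj linl.
- by rewrite -[1]/(quot_proj S 1) quot_act_proj rho1.
- elim/quot_proj_ind: x => x; elim/quot_proj_ind: y => y.
  have -> : quot_proj S x * quot_proj S y = quot_proj S (x * y) :> quotalg S.
    by rewrite /quot_proj -pi_mulE.
  by rewrite !quot_act_proj rhoM.
Qed.

Lemma quot_act_preserved (U : set V) : preserved rho U -> preserved quot_act U.
Proof. by move=> rhoU x; apply: rhoU. Qed.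

End QuotientAction.

(** * Derivatives and multiplications on Fock space *)

Section FockOperators.
Context (F : fieldType).
Implicit Types (f g : fock F) (k : posn) (m : {cmonom posn}) (h : int).

Lemma fock_eqP f g : (forall m h, f@_(m, h) = g@_(m, h)) -> f = g.
Proof. by move=> fg; apply/(proj1 (malgP f g)) => -[m h]. Qed.

Lemma fock_pderiv_linear k c f g :
  fock_pderiv k (c *: f + g) = c *: fock_pderiv k f + fock_pderiv k g.
Proof.
apply: (@malg_extend_linear F fmon (fock F) (fun (m : fmon) a =>
  << a * (m.1 k)%:R *g ((divcm m.1 (ucm k), m.2) : fmon) >>)) => m a b d.
by rewrite mulrDl monalgUD -mulrA -fock_scaleU.
Qed.

Lemma fock_pderivU k c (m : fmon) :
  fock_pderiv k (<< c *g m >> : fock F) =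
  << c * (m.1 k)%:R *g (divcm m.1 (ucm k), m.2) >>.
Proof.
apply: (@malg_extendU F fmon (fock F) (fun (m : fmon) a =>
  << a * (m.1 k)%:R *g ((divcm m.1 (ucm k), m.2) : fmon) >>)) => {m c} m a b d.
by rewrite mulrDl monalgUD -mulrA -fock_scaleU.
Qed.

Lemma fock_poly_linear c (p p' : {malg F[{cmonom posn}]}) :
  fock_poly (c *: p + p') = c *: fock_poly p + fock_poly p'.
Proof.
apply: (@malg_extend_linear F {cmonom posn} (fock F)
  (fun m a => << a *g ((m, 0) : fmon) >>)) => m a b d.
by rewrite monalgUD -fock_scaleU.
Qed.

Lemma fock_polyU c m : fock_poly << c *g m >> = << c *g (m, 0) >> :> fock F.
Proof.
apply: (@malg_extendU F {cmonom posn} (fock F)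
  (fun m a => << a *g ((m, 0) : fmon) >>)) => {m c} m a b d.
by rewrite monalgUD -fock_scaleU.
Qed.

Lemma fock_mulU c c' m m' h h' :
  (<< c *g (m, h) >> : fock F) * << c' *g (m', h') >>
  = << c * c' *g (mmul m m', h + h') >>.
Proof. exact: fock_mulUU. Qed.

Lemma fockXU k c m h :
  fockX F k * << c *g (m, h) >> = << c *g (mmul (ucm k) m, h) >>.
Proof. by rewrite fock_mulU mul1r add0r. Qed.

Lemma cmonom_mulK k m : divcm (mmul (ucm k) m) (ucm k) = m.
Proof. by apply/eqP/cmP => i; rewrite divcmE cmM addKn. Qed.

Lemma cmonom_divK k m : m k != 0%N -> mmul (ucm k) (divcm m (ucm k)) = m.
Proof.
move=> mk; apply/eqP/cmP => i; rewrite cmM divcmE cmU.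
by case: eqP => [<-|_]; rewrite ?subn0 // subnKC // lt0n.
Qed.

Lemma cmonom_mul_div k m m' :
  m k != 0%N -> divcm (mmul m' m) (ucm k) = mmul m' (divcm m (ucm k)).
Proof.
move=> mk; apply/eqP/cmP => i; rewrite cmM !divcmE cmM cmU addnBA //.
by case: eqP => [<-|_]; rewrite // lt0n.
Qed.

(** Reading derivatives off the coefficients makes them manifestly commute, and
    shows which coefficients survive. *)
Lemma fock_pderivE k f m h :
  (fock_pderiv k f)@_(m, h) = f@_(mmul (ucm k) m, h) *+ (m k).+1.
Proof.
elim/fock_ind: f => [|f g IHf IHg|c [m' h']].
- by rewrite (linear_map0 (fock_pderiv_linear k)) !mcoeff0 mul0rn.
- by rewrite (linear_mapD (fock_pderiv_linear k)) !mcoeffD IHf IHg mulrnDl.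
rewrite fock_pderivU !mcoeffU /= mulr_natr.
have [m'k|m'k] := eqVneq (m' k) 0%N.
  (* Here divcm truncates, but neither side has a nonzero coefficient. *)
  rewrite m'k mulr0n mul0rn.
  case: eqP => [[E _]|_]; last by rewrite mulr0n mul0rn.
  by move: m'k; rewrite E cmM cmUU.
rewrite -!mulrnA !xpair_eqE -{3}(cmonom_divK m'k).
have -> : (mmul (ucm k) (divcm m' (ucm k)) == mmul (ucm k) m)
          = (divcm m' (ucm k) == m).
  by apply/eqP/eqP => [E|-> //]; rewrite -(cmonom_mulK k m) -E cmonom_mulK.
case: eqP => [<-|_]; last by rewrite muln0 mul0n.
by rewrite divcmE cmUU subn1 prednK ?lt0n // mulnC.
Qed.

Lemma fock_pderivC j k f :
  fock_pderiv j (fock_pderiv k f) = fock_pderiv k (fock_pderiv j f).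
Proof.
apply: fock_eqP => m h.
have pderiv2 i l : (fock_pderiv i (fock_pderiv l f))@_(m, h)
    = f@_(mmul (ucm l) (mmul (ucm i) m), h)
      *+ ((mmul (ucm i) m l).+1 * (m i).+1).
  by rewrite !fock_pderivE mulrnA.
rewrite [LHS]pderiv2 [RHS]pderiv2.
have -> : mmul (ucm k) (mmul (ucm j) m) = mmul (ucm j) (mmul (ucm k) m).
  by rewrite mulmA [mmul (ucm k) _]mulmC -mulmA.
have -> // : ((mmul (ucm j) m k).+1 * (m j).+1
              = (mmul (ucm k) m j).+1 * (m k).+1)%N.
rewrite !cmM !cmU [k == j]eq_sym.
by case: eqP => [->|_]; rewrite // mulnC.
Qed.

Lemma fock_pderivX j k f :
  fock_pderiv j (fockX F k * f) = f *+ (j == k) + fockX F k * fock_pderiv j f.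
Proof.
elim/fock_ind: f => [|f g IHf IHg|c [m h]].
- by rewrite mulr0 (linear_map0 (fock_pderiv_linear j)) mulr0 mul0rn addr0.
- rewrite mulrDr !(linear_mapD (fock_pderiv_linear j)) IHf IHg mulrDr mulrnDl.
  by rewrite addrACA.
rewrite [in LHS]fockXU [LHS]fock_pderivU [in RHS]fock_pderivU [in RHS]fockXU /=.
rewrite cmM cmU natrD mulrDr monalgUD.
apply: (f_equal2 (fun u v : fock F => u + v)).
  rewrite eq_sym; case: eqP => [->|_]; last by rewrite mulr0 monalgU0.
  by rewrite mulr1 cmonom_mulK.
have [->|mj] := eqVneq (m j) 0%N; first by rewrite mulr0 !monalgU0.
by rewrite cmonom_mul_div.
Qed.

(** * Charge sectors *)

Lemma fockqU h c m :
  fockq F h * << c *g (m, 0) >> = << c *g (m, h) >>.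
Proof. by rewrite fock_mulU mul1r addr0 mul1m. Qed.

Lemma fockq_poly_linear h c (p p' : {malg F[{cmonom posn}]}) :
  fockq F h * fock_poly (c *: p + p')
  = c *: (fockq F h * fock_poly p) + fockq F h * fock_poly p'.
Proof. by rewrite fock_poly_linear mulrDr scalerAr. Qed.

Lemma fock_charge_subspace h : is_subspace (@fock_charge F h).
Proof.
split; first by exists 0 => //; apply: (linear_map0 (fockq_poly_linear h)).
move=> c _ _ [p _ <-] [p' _ <-]; exists (c *: p + p') => //.
exact: fockq_poly_linear.
Qed.

Lemma fock_charge_monomial c m h : fock_charge h (<< c *g (m, h) >> : fock F).
Proof. by exists << c *g m >> => //; rewrite fock_polyU fockqU. Qed.

(** A linear map sends a whole sector into U as soon as it does so on monomials;
    with [op := id] this is an inclusion of the sector in U. *)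
Lemma fock_charge_map h (op : fock F -> fock F) (U : set (fock F)) :
  (forall c u v, op (c *: u + v) = c *: op u + op v) -> is_subspace U ->
  (forall c m, U (op << c *g (m, h) >>)) ->
  forall f, fock_charge h f -> U (op f).
Proof.
move=> lin subU opU _ [p _ <-]; elim/malg_ind: p => [|p p' IHp IHp'|c m].
- by rewrite (linear_map0 (fockq_poly_linear h)) (linear_map0 lin); case: subU.
- rewrite (linear_mapD (fockq_poly_linear h)) (linear_mapD lin).
  exact: subspaceD.
- by rewrite fock_polyU fockqU.
Qed.

Lemma fock_charge_coeff h f (m : fmon) :
  fock_charge h f -> m.2 != h -> f@_m = 0.
Proof.
move=> Bf mh; pose U := [set g : fock F | g@_m = 0]%classic.
apply: (@fock_charge_map h id U) Bf => //.
  split=> [|c u v]; rewrite /U /= ?mcoeff0 // mcoeffD mcoeffZ => -> ->.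
  by rewrite mulr0 addr0.
move=> c m'; rewrite /U /= mcoeffU; case: eqP => // E.
by rewrite -E eqxx in mh.
Qed.

Lemma cmonom_neq1 m : m != mone -> exists k, m k != 0%N.
Proof.
move=> m1; apply: contrapT => /forallNP h; move/negP: m1; apply.
by apply/cmP => i; rewrite cm1; apply/eqP/negPn/negP/h.
Qed.

Lemma mdeg_divcm k m : m k != 0%N -> mdeg m = (mdeg (divcm m (ucm k))).+1.
Proof. by move=> mk; rewrite -{1}(cmonom_divK mk) mdegM mdegU. Qed.

(** By induction on the degree: a nonconstant monomial is x_k times a monomial
    of smaller degree. *)
Lemma fock_charge_generated h (U : set (fock F)) :
  is_subspace U -> (forall k f, U f -> U (fockX F k * f)) -> U (fockq F h) ->
  forall f, fock_charge h f -> U f.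
Proof.
move=> subU XU Uq f; apply: (@fock_charge_map h id U _ subU) => [//|c m].
rewrite -[c]mulr1 -fock_scaleU; apply: (subspaceZ subU) => {c}.
have [n] := ubnP (mdeg m); elim: n m => // n IHn m.
have [->|/cmonom_neq1[k mk]] := eqVneq m mone; first by [].
rewrite (mdeg_divcm mk) ltnS => /IHn Um.
by rewrite -(cmonom_divK mk) -fockXU; apply: XU.
Qed.

(** Differentiating by a variable that occurs in f lowers the degree without
    killing f, until only a multiple of q^h is left. *)
Lemma fock_charge_vacuum h (U : set (fock F)) f :
  [pchar F] =i pred0 ->
  is_subspace U -> (U `<=` @fock_charge F h)%classic ->
  (forall k g, U g -> U (fock_pderiv k g)) ->
  U f -> f != 0 -> U (fockq F h).
Proof.
move=> char0 subU Uh dU.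
(* n bounds the degree of f; the induction is on this bound. *)
have [n] : exists n, forall m h', f@_(m, h') != 0 -> (mdeg m <= n)%N.
  exists (\max_(m <- msupp f) mdeg m.1)%N => m h'; rewrite mcoeff_neq0 => mf.
  exact: (@leq_bigmax_seq _ _ xpredT (fun m : fmon => mdeg m.1) (m, h') mf).
elim: n f => [|n IHn] f fn Uf f0.
  have fE : f = f@_(mone, h) *: fockq F h.
    apply: fock_eqP => m h'; rewrite mcoeffZ mcoeffU xpair_eqE.
    have [<-|hh'] /= := eqVneq h h'; last first.
      by rewrite andbF mulr0 (fock_charge_coeff (Uh _ Uf)) // eq_sym.
    rewrite andbT; have [<-|m1] := eqVneq; first by rewrite mulr1.
    rewrite mulr0; apply/eqP/negPn/negP => /fn.
    by rewrite leqn0 mdeg_eq0 eq_sym (negPf m1).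
  have c0 : f@_(mone, h) != 0.
    by apply: contraNneq f0 => c0; rewrite fE c0 scale0r.
  rewrite -[fockq F h]scale1r -(mulVf c0) -scalerA -fE.
  exact: subspaceZ.
have [[[m h'] [fm /cmonom_neq1[k mk]]]|noder] :=
    pselect (exists m : fmon, f@_m != 0 /\ m.1 != mone); last first.
  apply: IHn Uf f0 => m h' fm; rewrite [m](_ : _ = mone) ?mdeg1 //.
  by apply/eqP/negPn/negP => m1; apply: noder; exists (m, h').
(* The monomial m / x_k occurs in the derivative, with coefficient
   m k times that of m in f. *)
apply: (IHn (fock_pderiv k f)); last 1 first.
- apply/eqP => /malgP/(_ (divcm m (ucm k), h'))/eqP; apply/negP.
  rewrite mcoeff0 fock_pderivE (cmonom_divK mk) -mulr_natr mulf_neq0 //.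
  by rewrite ((pcharf0P _).1 char0).
- move=> m' h''; rewrite fock_pderivE => dm'.
  have /fn : f@_(mmul (ucm k) m', h'') != 0.
    by apply: contraNneq dm' => ->; rewrite mul0rn.
  by rewrite mdegM mdegU.
- exact: dU.
Qed.

End FockOperators.

(** * The Weyl algebra action *)

Section WeylAction.
Context (F : fieldType).

Definition fock_alpha (k : nzint) (v : fock F) : fock F :=
  if 0 < val k then fock_pderiv (absnz k) v
  else ((- val k)%:~R *: fockX F (absnz k)) * v.

Definition heis_op (i : option nzint) : fock F -> fock F :=
  if i is Some k then fock_alpha k else id.

Lemma fock_alpha_linear k c u v :
  fock_alpha k (c *: u + v) = c *: fock_alpha k u + fock_alpha k v.
Proof.
rewrite /fock_alpha; case: ifP => _; first exact: fock_pderiv_linear.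
by rewrite mulrDr scalerAr.
Qed.

Lemma heis_op_linear i c u v :
  heis_op i (c *: u + v) = c *: heis_op i u + heis_op i v.
Proof. by case: i => //= k; apply: fock_alpha_linear. Qed.

Lemma nzint_lt0 (k : nzint) : ~~ (0 < val k) -> val k < 0.
Proof. by rewrite -leNgt le_eqVlt (negPf (valP k)). Qed.

Lemma fock_alpha_comm_pos_neg (j k : nzint) v : 0 < val j -> val k < 0 ->
  fock_alpha j (fock_alpha k v) - fock_alpha k (fock_alpha j v)
  = ((val j)%:~R * (val j == - val k)%:R) *: v.
Proof.
move=> j0 k0; rewrite /fock_alpha j0 ltNge (ltW k0) /= -!scalerAl.
rewrite -[_ *: (_ * v)]addr0 fock_pderiv_linear.
rewrite (linear_map0 (fock_pderiv_linear _)) addr0.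
rewrite -scalerBr fock_pderivX addrK -scaler_nat scalerA.
congr (_ *: v); have -> : (absnz j == absnz k) = (val j == - val k).
  by rewrite -val_eqE /= -(gtz0_abs j0) -(ltz0_abs k0).
by case: eqP => [->|_]; rewrite ?mulr0.
Qed.

(** The Heisenberg relation with c = 1.  If j and k have the same sign then j is
    not -k and the operators commute. *)
Lemma fock_alpha_comm (j k : nzint) v :
  fock_alpha j (fock_alpha k v) - fock_alpha k (fock_alpha j v)
  = ((val j)%:~R * (val j == - val k)%:R) *: v.
Proof.
have [j0|/nzint_lt0 j0] := boolP (0 < val j);
have [k0|/nzint_lt0 k0] := boolP (0 < val k).
- rewrite /fock_alpha j0 k0 fock_pderivC subrr.
  rewrite [_ == _]negbTE ?mulr0 ?scale0r //.
  by apply: contraTneq j0 => ->; rewrite oppr_gt0 ltNge ltW.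
- exact: fock_alpha_comm_pos_neg.
- rewrite -opprB fock_alpha_comm_pos_neg // -scaleNr; congr (_ *: v).
  rewrite [val k == _]eq_sym eqr_oppLR.
  case: eqP => [->|_]; last by rewrite !mulr0 oppr0.
  by rewrite !mulr1 rmorphN.
- rewrite /fock_alpha !ltNge (ltW j0) (ltW k0) /= [X in X - _]mulrCA subrr.
  rewrite [_ == _]negbTE ?mulr0 ?scale0r //.
  by apply/eqP => E; move: j0; rewrite /= E oppr_lt0 ltNge (ltW k0).
Qed.

Definition heis_act := free_act heis_op.

Lemma heis_rel_act r v : @heis_rel F r -> heis_act r v = 0.
Proof.
have rep := free_act_rep heis_op_linear.
have [_ _ _ actM] := rep.
case=> [[j [k ->]]|[k ->]]; rewrite /heis_act.
  rewrite (repB rep) [X in X - _](repB rep) [X in _ - X](repZ rep).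
  rewrite [X in X - _ - _]actM [X in _ - X - _]actM !free_act_gen.
  by rewrite [X in X - _]fock_alpha_comm subrr.
by rewrite (repB rep) [X in X - _]actM [X in _ - X]actM !free_act_gen subrr.
Qed.

Definition heisenberg_act : heisenberg F -> fock F -> fock F :=
  quot_act heis_act.

Lemma heisenberg_act_rep : is_representation heisenberg_act.
Proof. exact: quot_act_rep (free_act_rep heis_op_linear) heis_rel_act. Qed.

Lemma heisenberg_act_proj a v :
  heisenberg_act (quot_proj (@heis_rel F) a) v = heis_act a v.
Proof. exact: quot_act_proj (free_act_rep heis_op_linear) heis_rel_act _ _. Qed.

Lemma weyl_rel_act r v : @weyl_rel F r -> heisenberg_act r v = 0.
Proof.
have [_ _ act1 _] := heisenberg_act_rep.
move=> ->; rewrite (repB heisenberg_act_rep) act1 heisenberg_act_proj.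
by rewrite /heis_act free_act_gen subrr.
Qed.

Definition weyl_act : weyl F -> fock F -> fock F := quot_act heisenberg_act.

Lemma weyl_act_rep : is_representation weyl_act.
Proof. exact: quot_act_rep heisenberg_act_rep weyl_rel_act. Qed.

Lemma weyl_act_alpha k v : weyl_act (alpha F k) v = fock_alpha k v.
Proof.
rewrite [LHS](quot_act_proj heisenberg_act_rep weyl_rel_act).
by rewrite heisenberg_act_proj /heis_act free_act_gen.
Qed.

Lemma fock_alpha_charge h k f :
  fock_charge h f -> fock_charge h (fock_alpha k f).
Proof.
have subB := @fock_charge_subspace F h; move: f.
apply: (fock_charge_map (fock_alpha_linear k) subB) => c m.
rewrite /fock_alpha; case: ifP => _.
  by rewrite fock_pderivU; apply: fock_charge_monomial.
rewrite -scalerAl fockXU; apply: (subspaceZ subB).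
exact: fock_charge_monomial.
Qed.

(** It is enough to check the generators. *)
Lemma weyl_act_charge h : preserved weyl_act (@fock_charge F h).
Proof.
apply: quot_act_preserved; apply: quot_act_preserved.
apply: free_act_preserved; first exact: fock_charge_subspace.
by move=> [k|] f //=; apply: fock_alpha_charge.
Qed.

Lemma posn_nzint_neq0 (k : posn) : (Posz (val k) != 0) * (- Posz (val k) != 0).
Proof. by rewrite oppr_eq0 eqz_nat -lt0n; split; exact: (valP k). Qed.

Lemma fock_charge_irreducible h :
  [pchar F] =i pred0 -> irreducible_on weyl_act (@fock_charge F h).
Proof.
move=> char0; split.
  move=> E; have := fock_charge_monomial (1 : F) mone h; rewrite E => /eqP.
  by rewrite monalgU_eq0 oner_eq0.
move=> U subU actU Uh.
(* U is stable under each derivative and each multiplication by a variable,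
   the latter after dividing alpha_{-k} by the nonzero scalar k. *)
have dU k f : U f -> U (fock_pderiv k f).
  pose j : nzint := Sub (Posz (val k)) (posn_nzint_neq0 k).1.
  move=> /(actU (alpha F j)); rewrite weyl_act_alpha /fock_alpha.
  have -> : absnz j = k by apply: val_inj.
  by rewrite /= ltz_nat (valP k).
have XU k f : U f -> U (fockX F k * f).
  pose j : nzint := Sub (- Posz (val k)) (posn_nzint_neq0 k).2.
  move=> /(actU (alpha F j)); rewrite weyl_act_alpha /fock_alpha.
  have -> : absnz j = k by apply: val_inj; rewrite /= abszN.
  rewrite /= oppr_gt0 ltz_nat ltn0 opprK -scalerAl.
  have k0 : (val k)%:R != 0 :> F.
    by rewrite ((pcharf0P _).1 char0) -lt0n (valP k).
  by move=> /(subspaceZ subU (val k)%:R^-1); rewrite scalerA mulVf // scale1r.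
have [[f [Uf f0]]|U0] := pselect (exists f, U f /\ f != 0); [right|left].
  apply/seteqP; split=> // g; apply: fock_charge_generated => //.
  exact: fock_charge_vacuum Uf f0.
apply/seteqP; split=> [f Uf|f ->]; last by case: subU.
by apply/eqP/negPn/negP => f0; apply: U0; exists f.
Qed.

End WeylAction.

Theorem proposition3p5 (R : realType) :
  exists rho : weyl R[i] -> fock R[i] -> fock R[i],
  [/\ is_representation rho,
      (forall (k : nzint) (v : fock R[i]), 0 < val k ->
         rho (alpha R[i] k) v = fock_pderiv (absnz k) v),
      (forall (k : nzint) (v : fock R[i]), val k < 0 ->
         rho (alpha R[i] k) v = ((- val k)%:~R *: fockX R[i] (absnz k)) * v)
    & forall h : int,
        [/\ is_subspace (@fock_charge R[i] h),
            preserved rho (@fock_charge R[i] h)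
          & irreducible_on rho (@fock_charge R[i] h)]].
Proof.
exists (@weyl_act R[i]); split=> [|k v k0|k v k0|h].
- exact: weyl_act_rep.
- by rewrite weyl_act_alpha /fock_alpha k0.
- by rewrite weyl_act_alpha /fock_alpha ltNge ltW.
split; [exact: fock_charge_subspace|exact: weyl_act_charge|].
exact/fock_charge_irreducible/pchar_num.
Qed.
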